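(* Let $n,k,d,r$ be integers with $d\ge 1$, $r\ge 0$, $1\le k\le n$, $n-d-r=2$ and $n \bmod 2=0$. Let $\mathcal{M}=\sum_{i=1}^k (d-y_i(\pi_f^* ))$ be the file size in packets (a positive integer), and let $\mathcal{H}$ be the finite set of integer vectors defined in the context. Let $q$ be any prime power with $q>nd\mathcal{M}|\mathcal{H}|$, and let $\mathbb{F}=\mathrm{GF}(q)$. Then there exist linear codes over $\mathbb{F}$ with $\alpha=d$ packets stored per node and $\beta=1$ packet sent per helper that protect a file of $\mathcal{M}$ packets against any $n-k$ simultaneous failures under the modified family helper selection (MFHS) scheme. Precisely: there exist initial $\mathcal{M}\times d$ matrices $\mathbf{Q}_1,\dots,\mathbf{Q}_n$ over $\mathbb{F}$ such that, for every (arbitrarily long) sequence of failure/repair events, where the event at stage $t$ consists of a failing node $f$ and an arbitrary set of $d$ distinct helpers $\{x_1,\dots,x_d\}\subseteq\overline{D}(f)$, one can choose at each stage, on the basis of the events up to and including that stage and of the earlier choices, column vectors $\mathbf{b}_1,\dots,\mathbf{b}_d\in\mathbb{F}^{d}$ and a matrix $\mathbf{Z}\in\mathbb{F}^{d\times d}$, and replace $\mathbf{Q}_f$ by $$\mathbf{Q}_f'=[\mathbf{Q}_{x_1}\mathbf{b}_1,\dots,\mathbf{Q}_{x_d}\mathbf{b}_d]\,\mathbf{Z}$$ (all other matrices being unchanged), in such a way that at all times (initially and after every stage), for every set of $k$ distinct nodes $\{i_1,\dots,i_k\}\subseteq\{1,\dots,n\}$, the $\mathcal{M}\times kd$ matrix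 $[\mathbf{Q}_{i_1},\dots,\mathbf{Q}_{i_k}]$ of current coding matrices has rank $\mathcal{M}$.
   Context: Families. The $n$ storage nodes $\{1,\dots,n\}$ ($n$ even) are partitioned into $n/2$ families of size $n-d-r=2$: family $a$ is $\{2a-1,2a\}$, $a=1,\dots,n/2$. $FI(i)$ denotes the family index of node $i$. In the MFHS scheme with these parameters, the set of helper candidates of node $f$ is $\overline{D}(f)=\{j: FI(j)\ne FI(f)\}$, the $n-2=d+r$ nodes outside the family of $f$. When $f$ fails (up to $r$ candidates may be unavailable), the newcomer contacts some $d$ nodes of $\overline{D}(f)$. Codes. The file is an $\mathcal{M}\times W$ matrix $\mathbf{X}$ over $\mathbb{F}$, and node $i$ stores the $d$ packets $\mathbf{X}^{T}\mathbf{Q}_i$ with $\mathbf{Q}_i\in\mathbb{F}^{\mathcal{M}\times d}$. Thus $\mathbf{Q}_1,\dots,\mathbf{Q}_n$ specify the code, and the file can be reconstructed from a set of nodes iff the concatenation of their matrices has rank $\mathcal{M}$. File size. $\pi_f^*=(1,2,\dots,n/2,1,2,\dots,n/2)$ is the rotating family index permutation (a vector of length $n$), and $y_i(\pi_f^* )$ is the number of indices $j<i$ with $\pi_f^*(j)\neq\pi_f^*(i)$. Vectors $\mathbf{b}(\pi),\mathbf{c}(\pi)$. For a permutation $\pi$ of the nodes $(1,\dots,n)$, let $z_i(\pi)$ be the number of $j<i$ with $FI(\pi(j))\neq FI(\pi(i))$, and let $b_i(\pi)=(d-z_i(\pi))^+$, where $x^+=\max(x,0)$. Let $m$ be the smallest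 index with $\sum_{i=1}^m b_i(\pi)\ge\mathcal{M}$. Then $c_i(\pi)=b_i(\pi)$ for $i<m$, $c_m(\pi)=\mathcal{M}-\sum_{i=1}^{m-1}b_i(\pi)$, and $c_i(\pi)=0$ for $i>m$. (For example, for $(n,k,d,r)=(6,4,3,1)$ and $\pi=(2,3,4,1,5,6)$: $\mathcal{M}=7$, $\mathbf{b}(\pi)=(3,2,2,1,0,0)$, $\mathbf{c}(\pi)=(3,2,2,0,0,0)$.) Majorization. For $n$-dimensional vectors, $\mathbf{a}\succeq\mathbf{b}$ means $\sum_{i=1}^m a_{[i]}\ge\sum_{i=1}^m b_{[i]}$ for all $m=1,\dots,n$, where $a_{[i]}$, $b_{[i]}$ denote the $i$-th largest coordinates. The set $\mathcal{H}$. $\mathbf{h}\in\mathcal{H}$ iff (i) $\mathbf{h}$ is an $n$-dimensional integer vector with $0\le h_i\le d$ for all $i$, and (ii) there is a node permutation $\pi$ with $h_{\pi(i)}\ge h_{\pi(i+1)}$ for $i=1,\dots,n-1$ and $\mathbf{c}(\pi)\succeq\mathbf{h}$. *)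

(* Defs.v *)
From HB Require Import structures.
From mathcomp Require Import all_boot all_order all_fingroup all_algebra.

Set Implicit Arguments.
Unset Strict Implicit.
Unset Printing Implicit Defensive.

Import GRing.Theory.

Local Open Scope ring_scope.

(* Nodes and positions 1, ..., n are the ordinals 0, ..., n - 1 of 'I_n, so   *)
(* node i of the mathematics is the ordinal i - 1.  Values of family indices  *)
(* remain 1, ..., n / 2.                                                      *)

Definition FI (n : nat) (i : 'I_n) : nat := (i./2).+1.

Definition helper_candidates (n : nat) (f : 'I_n) : {set 'I_n} :=
  [set j | FI j != FI f].

Definition num_diff_before (n : nat) (v : 'I_n -> nat) (i : 'I_n) : nat :=
  #|[set j : 'I_n | (j < i)%N & v j != v i]|.

Definition rfip (n : nat) (i : 'I_n) : nat :=
  nth 0%N (iota 1 n./2 ++ iota 1 n./2) i.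

(* The terms are not truncated at 0, hence the sum in int.                    *)
Definition file_size (n k d : nat) : int :=
  \sum_(i < n | (i < k)%N) (d%:Z - (num_diff_before (@rfip n) i)%:Z).

Definition bvec (n d : nat) (pi : 'S_n) (i : 'I_n) : nat :=
  (d - num_diff_before (fun j => FI (pi j)) i)%N.

(* The 0-based m.  The default value n is returned when sum_i b_i(pi) < M.    *)
Definition cut_index (n d M : nat) (pi : 'S_n) : nat :=
  find (fun m => M <= \sum_(i < n | (i <= m)%N) bvec d pi i)%N (iota 0 n).

Definition cvec (n d M : nat) (pi : 'S_n) (i : 'I_n) : nat :=
  let m := cut_index d M pi in
  if (i < m)%N then bvec d pi i
  else if i == m :> nat then (M - \sum_(j < n | (j < m)%N) bvec d pi j)%N
  else 0%N.

Definition sum_largest (n : nat) (a : 'I_n -> nat) (m : nat) : nat :=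
  sumn (take m (sort geq [seq a i | i <- enum 'I_n])).

(* As in the source, equality of the total sums is not required.              *)
Definition majorizes (n : nat) (a b : 'I_n -> nat) : bool :=
  [forall m : 'I_n, (sum_largest b m.+1 <= sum_largest a m.+1)%N].

Definition Hset (n d M : nat) : {set {ffun 'I_n -> 'I_d.+1}} :=
  [set h : {ffun 'I_n -> 'I_d.+1} | [exists pi : 'S_n,
     [forall i : 'I_n, forall j : 'I_n,
        (j == i.+1 :> nat) ==> (h (pi j) <= h (pi i))%N]
     && majorizes (cvec d M pi) (fun i => h i)]].

(* The coding matrices Q_1, ..., Q_n.                                         *)
Definition code (F : fieldType) (n M d : nat) := 'I_n -> 'M[F]_(M, d).

(* The failing node f and the distinct helpers x_1, ..., x_d.                 *)
Definition event (n d : nat) := ('I_n * d.-tuple 'I_n)%type.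

Definition valid_event (n d : nat) (e : event n d) : bool :=
  uniq e.2 && all (mem (helper_candidates e.1)) e.2.

(* The column vectors b_1, ..., b_d and the matrix Z.                         *)
Definition repair_choice (F : fieldType) (d : nat) :=
  (('I_d -> 'cV[F]_d) * 'M[F]_d)%type.

Definition repaired (F : fieldType) (n M d : nat)
    (Q : code F n M d) (e : event n d) (c : repair_choice F d) : 'M[F]_(M, d) :=
  (\matrix_(u < M, j < d) (Q (tnth e.2 j) *m c.1 j) u 0) *m c.2.

Definition repair (F : fieldType) (n M d : nat)
    (Q : code F n M d) (e : event n d) (c : repair_choice F d) : code F n M d :=
  fun i => if i == e.1 then repaired Q e c else Q i.

(* Past events with the choices made for them, oldest first.                  *)
Definition history (F : fieldType) (n d : nat) :=
  seq (event n d * repair_choice F d).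

Definition strategy (F : fieldType) (n d : nat) :=
  history F n d -> event n d -> repair_choice F d.

(* The code reached from Q, with past hist, after the further events evs.     *)
Fixpoint run (F : fieldType) (n M d : nat) (sigma : strategy F n d)
    (hist : history F n d) (Q : code F n M d) (evs : seq (event n d))
    : code F n M d :=
  if evs is e :: evs' then
    let c := sigma hist e in
    run sigma (rcons hist (e, c)) (repair Q e c) evs'
  else Q.

(* Main.v *)
Require Import Defs.
From HB Require Import structures.
From mathcomp Require Import all_boot all_order all_fingroup all_algebra.
From mathcomp Require Import zify.

Set Implicit Arguments.
Unset Strict Implicit.
Unset Printing Implicit Defensive.

Import GRing.Theory Num.Theory.

Local Open Scope ring_scope.

(* Let rho(S) be the minimum of M and sum_{i < |S|} (d - i)^+ + p(S), where    *)
(* p(S) is the number of families contained in S.  As every set S of more      *)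
(* than d nodes has rho(S) = M, rho is a polymatroid rank function, and its    *)
(* independent vectors h all lie in H.  The invariant of the codes is that for *)
(* each independent h the first h_i columns of the Q_i are linearly            *)
(* independent. Every k nodes support an independent h of sum M, whence the    *)
(* rank.  When f is repaired from the helpers X, uncrossing of tight sets      *)
(* gives J in X with |J| = h_f such that resetting h_f to 0 and adding 1 on J  *)
(* keeps h independent: for h alone one could take b_j to be the next column   *)
(* of each helper in J and for Z a selection of these.  The b_j, and then the  *)
(* columns of Z, are made common to all h one after the other, each time by    *)
(* avoiding at most |H| < q proper subspaces.                                  *)

(** * Polymatroids *)

(** The sequence of failures is unbounded, but the invariant [good_code] is a finite list of
    conditions, one per independent vector, so one field size serves all stages. [file_size_le_cut]
    ties the file size to the rank function, and [independent_vectors_sub] bounds the number of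
    conditions by that of H. A stage preserves the invariant by [good_code_repair], which joins the
    exchange argument [independent_repair] to the simultaneous genericity of [common_choice].
    [independent_base] and [good_code_rank] turn the invariant into reconstruction. *)

Definition polymatroid (T : finType) (rho : {set T} -> nat) : Prop :=
  [/\ rho set0 = 0%N,
      forall A B : {set T}, A \subset B -> (rho A <= rho B)%N
    & forall A B, (rho (A :|: B) + rho (A :&: B) <= rho A + rho B)%N].

Definition independent (T : finType) (rho : {set T} -> nat) (h : T -> nat) :=
  [forall S : {set T}, (\sum_(i in S) h i <= rho S)%N].

Lemma set_monotone (T : finType) (f : {set T} -> nat) :
  (forall (x : T) (S : {set T}), f S <= f (x |: S))%N ->
  forall A B : {set T}, A \subset B -> (f A <= f B)%N.
Proof.
move=> f_mono A B /setUidPr <-; rewrite setUC -(set_enum B).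
elim: (enum B) => [|x s IH] //; first by rewrite set_nil set0U.
by apply: leq_trans IH _; rewrite set_cons -setUA.
Qed.

(** Diminishing increments for single elements suffice: add the elements of A one by one to
    [A :&: B] and to B and sum the increments. An element already in the larger set adds nothing
    there, so monotonicity covers that case. *)
Lemma polymatroid_local (T : finType) (rho : {set T} -> nat) :
  rho set0 = 0%N -> (forall (x : T) (S : {set T}), rho S <= rho (x |: S))%N ->
  (forall (x : T) (A B : {set T}), A \subset B -> x \notin B ->
     rho (x |: B) + rho A <= rho B + rho (x |: A))%N ->
  polymatroid rho.
Proof.
move=> rho0 /set_monotone rho_mono rho_loc; split=> // A B.
have loc x (C D : {set T}) :
    (C \subset D -> rho (x |: D) + rho C <= rho D + rho (x |: C))%N.
  move=> sCD; have [xD|] := boolP (x \in D); last exact: rho_loc.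
  rewrite (setUidPr _) ?sub1set // leq_add2l rho_mono ?subsetUr //.
suff gen (s : seq T) (C D : {set T}) : C \subset D ->
    (rho ([set:: s] :|: D) + rho C <= rho D + rho ([set:: s] :|: C))%N.
  have := gen (enum A) (A :&: B) B (subsetIr _ _).
  by rewrite set_enum setUIr setUid (setIidPl (subsetUl _ _)) [X in (_ <= X)%N]addnC.
move=> sCD; elim: s => [|x s IH]; first by rewrite set_nil !set0U.
rewrite set_cons -!setUA.
have := loc x ([set:: s] :|: C) ([set:: s] :|: D) (setUS _ sCD); lia.
Qed.

Lemma independent_le (T : finType) (rho : {set T} -> nat) (h h' : T -> nat) :
  (forall i, h' i <= h i)%N -> independent rho h -> independent rho h'.
Proof.
move=> le_h /forallP hP; apply/forallP=> S.
by apply: leq_trans (hP S); apply: leq_sum.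
Qed.

(* Tight sets are closed under unions by submodularity. *)
Lemma tight_bigcup (T : finType) (rho : {set T} -> nat) (h : T -> nat)
    (P : pred T) (t : T -> {set T}) :
  polymatroid rho -> independent rho h ->
  (forall x, P x -> rho (t x) <= \sum_(i in t x) h i)%N ->
  (\sum_(i in \bigcup_(x | P x) t x) h i)%N = rho (\bigcup_(x | P x) t x).
Proof.
move=> [rho0 _ rho_sub] /forallP hP tP; apply/eqP; rewrite eqn_leq hP /=.
apply: (big_ind (fun S => rho S <= \sum_(i in S) h i)%N) => //.
  by rewrite rho0.
move=> A B hA hB.
have e : (\sum_(i in A :|: B) h i + \sum_(i in A :&: B) h i =
          \sum_(i in A) h i + \sum_(i in B) h i)%N.
  rewrite ![\sum_(_ in _) _]big_mkcond -!big_split /=; apply: eq_bigr => i _.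
  by rewrite !inE; case: (i \in A); case: (i \in B) => //=; lia.
have := rho_sub A B; have := hP (A :&: B); lia.
Qed.

(** Greedy raising of h0 under the cap h0 + u. At a maximal h every coordinate below its cap is
    blocked by a tight set, and the union S of these is tight; S certifies maximality. *)
Lemma independent_maximal (T : finType) (rho : {set T} -> nat)
    (h0 u : T -> nat) :
  polymatroid rho -> independent rho h0 ->
  exists h : T -> nat, exists2 S : {set T},
    [/\ independent rho h, (forall i, h0 i <= h i)%N
      & (forall i, h i <= h0 i + u i)%N]
    & (\sum_(i in S) h i)%N = rho S /\ forall i, i \notin S -> h i = (h0 i + u i)%N.
Proof.
move=> rhoP; have [m] := ubnP (\sum_i u i)%N; elim: m h0 u => // m IH h0 u.
rewrite ltnS => u_m h0P.
pose inc (x : T) i := (h0 i + (i == x))%N.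
have [/existsP[x /andP[ux hx]]|no] :=
    boolP [exists x, (0 < u x)%N && independent rho (inc x)].
  pose u' i := (u i - (i == x))%N.
  have uE i : u i = (u' i + (i == x))%N.
    by rewrite /u'; case: eqP => [->|_] /=; lia.
  have /IH /(_ hx) : (\sum_i u' i < m)%N.
    apply: leq_trans u_m; rewrite (eq_bigr _ (fun i _ => uE i)) big_split /=.
    by rewrite -addn1 leq_add2l (bigD1 x) //= eqxx.
  case=> h [S [hP h_ge h_le] [hS hN]]; exists h, S; last split=> //.
    split=> // i; first by apply: leq_trans (h_ge i); rewrite leq_addr.
    by apply: leq_trans (h_le i) _; rewrite uE /inc; lia.
  by move=> i /hN ->; rewrite uE /inc; lia.
(* The set violated by a unit increment at x must contain x, and it is exceeded by only one, so it
   was tight. *)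
have tight x : (0 < u x)%N ->
    exists2 S : {set T}, x \in S & (rho S <= \sum_(i in S) h0 i)%N.
  move=> ux; move/existsPn/(_ x): no; rewrite ux /= => /forallPn[S].
  rewrite -ltnNge => hS; have xS : x \in S.
    apply: contraTT hS => xS; rewrite -leqNgt.
    apply: leq_trans (forallP h0P S); apply: leq_sum => i iS.
    by rewrite /inc; case: eqP xS => [<-|_] /=; rewrite ?iS // addn0.
  exists S => //; move: hS; rewrite big_split /= [X in (_ < _ + X)%N](bigD1 x) //= eqxx.
  rewrite [X in (_ < _ + (_ + X))%N]big1 => [|i /andP[_ /negPf ->]] //; lia.
pose t x : {set T} :=
  odflt set0 [pick S : {set T} | (x \in S) && (rho S <= \sum_(i in S) h0 i)%N].
have tP x : (0 < u x)%N -> (x \in t x) && (rho (t x) <= \sum_(i in t x) h0 i)%N.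
  move=> /tight[S xS hS]; rewrite /t; case: pickP => //= /(_ S).
  by rewrite xS hS.
exists h0, (\bigcup_(x | (0 < u x)%N) t x).
  by split=> // i; rewrite leq_addr.
split; first by apply: tight_bigcup => // x /tP /andP[].
move=> i; case: (posnP (u i)) => [->|ui]; first by rewrite addn0.
by case/negP; apply/bigcupP; exists i => //; case/andP: (tP i ui).
Qed.

(** * Simultaneous choice of vectors *)

(** Induction on the list. If b avoids the tail but lies in W, take b' outside W and move along the
    line b' + c b: it misses W entirely and meets each tail subspace at most once, so some c in F is
    left. *)
Lemma avoid_subspaces (F : finFieldType) (U : vectType F)
    (s : seq {vspace U}) :
  (size s < #|F|)%N -> all (fun W => W != fullv) s ->
  exists b : U, all (fun W : {vspace U} => b \notin W) s.
Proof.
elim: s => [|W s IH] /=; first by exists 0.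
move=> lt_s /andP[W_full s_full].
have [b bs] := IH (ltnW lt_s) s_full.
have [bW|] := boolP (b \in W); last by move=> bW; exists b; rewrite bW.
have /subvPn[b' _ b'W] : ~~ (fullv <= W)%VS.
  by apply: contra W_full => fW; rewrite eqEsubv subvf.
pose bad r := [set c : F | has (fun Wi : {vspace U} => b' + c *: b \in Wi) r].
have bad_le r : all (fun Wi : {vspace U} => b \notin Wi) r -> (#|bad r| <= size r)%N.
  elim: r => [|Wi r IHr] /=.
    by rewrite leqn0 cards_eq0 => _; apply/eqP/setP=> c; rewrite !inE.
  move=> /andP[bWi /IHr br].
  have -> : bad (Wi :: r) = [set c : F | b' + c *: b \in Wi] :|: bad r.
    by apply/setP=> c; rewrite !inE.
  apply: leq_trans (leq_card_setU _ _) _; rewrite -add1n; apply: leq_add br.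
  apply/card_le1_eqP => c e; rewrite !inE => cW eW.
  apply: contraNeq bWi => ce; move: (memvB cW eW).
  by rewrite opprD addrACA subrr add0r -scalerBl rpredZeq subr_eq0 eq_sym (negPf ce).
have /set0Pn[c] : ~: bad s != set0.
  rewrite -card_gt0 -(ltn_add2l #|bad s|) addn0 cardsC.
  exact: leq_ltn_trans (bad_le _ bs) (ltnW lt_s).
rewrite !inE -all_predC => cs; exists (b' + c *: b).
rewrite cs andbT; apply: contra b'W => h.
by rewrite -(addrK (c *: b) b') memvB // memvZ.
Qed.

Lemma dimv_add_lines (F : fieldType) (V : vectType F) (I : finType)
    (W : {vspace V}) (P : pred I) (v : I -> V) :
  (\dim (W + \sum_(j | P j) <[v j]>) <= \dim W + #|P|)%N.
Proof.
apply: leq_trans (dimv_add_leqif _ _).1 _; rewrite leq_add2l -sum1_card.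
apply: leq_trans (dimv_leq_sum _ _ _) _; apply: leq_sum => j _.
by rewrite dim_vline leq_b1.
Qed.

Lemma dimv_add_line (F : fieldType) (V : vectType F) (W : {vspace V}) (v : V) :
  \dim (W + <[v]>) = (\dim W + (v \notin W))%N.
Proof.
have [vW|vW] /= := boolP (v \in W).
  by rewrite (addv_idPl _) ?addn0 // -memvE.
apply/eqP; rewrite eqn_leq; apply/andP; split.
  by apply: leq_trans (dimv_add_leqif _ _).1 _; rewrite leq_add2l dim_vline leq_b1.
rewrite addn1 (ltn_leqif (dimv_leqif_sup (addvSl _ _))).
by apply: contra vW; rewrite subv_add -memvE => /andP[].
Qed.

(* Replace the vectors b0 h j by a common b j, one index j at a time; each     *)
(* replacement only has to avoid the proper subspaces                          *)
(* (L j)^-1 (W h + \sum_(i in J h, i != j) <[v i]>), one for each h.           *)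
Lemma common_choice (F : finFieldType) (V U : vectType F) (I T : finType)
    (L : I -> 'Hom(U, V)) (A : {set T}) (W : T -> {vspace V})
    (J : T -> {set I}) (b0 : T -> I -> U) :
  (#|A| < #|F|)%N ->
  {in A, forall h, \dim (W h + \sum_(j in J h) <[L j (b0 h j)]>) =
                   (\dim (W h) + #|J h|)%N} ->
  exists b : I -> U,
  {in A, forall h, \dim (W h + \sum_(j in J h) <[L j (b j)]>) =
                   (\dim (W h) + #|J h|)%N}.
Proof.
move=> ltAF b0P.
suff /(_ (enum I))[b bP] : forall s : seq I, exists b : I -> U, {in A, forall h,
    \dim (W h + \sum_(j in J h) <[L j (if j \in s then b j else b0 h j)]>) =
    (\dim (W h) + #|J h|)%N}.
  exists b => h hA; rewrite -bP //; congr (\dim (_ + _)%VS).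
  by apply: eq_bigr => j _; rewrite mem_enum.
elim=> [|x s [b bP]]; first by exists (fun=> 0).
pose v h j := L j (if j \in s then b j else b0 h j).
pose W' h := (W h + \sum_(j in J h | j != x) <[v h j]>)%VS.
have sumD1 (w : I -> V) h : x \in J h ->
    (W h + \sum_(j in J h) <[w j]> =
     (W h + \sum_(j in J h | j != x) <[w j]>) + <[w x]>)%VS.
  by move=> xJ; rewrite (bigD1 x) //= [(<[w x]> + _)%VS]addvC addvA.
(* The dimension is the largest possible, so each line adds exactly one; the line of index x thus
   leaves the span of the others. *)
have W'P h : h \in A -> x \in J h ->
    v h x \notin W' h /\ \dim (W' h) = (\dim (W h) + #|J h|).-1.
  move=> hA xJ; have := bP h hA; rewrite -/(v h _) sumD1 // dimv_add_line -/(W' h).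
  have := @dimv_add_lines F V I (W h) (fun j => (j \in J h) && (j != x)) (v h).
  have -> : #|(fun j => (j \in J h) && (j != x))| = #|J h :\ x|.
    by apply: eq_card => j; rewrite !inE andbC.
  rewrite -/(W' h); have := cardsD1 x (J h); rewrite xJ.
  by case: (v h x \notin W' h) => /=; lia.
pose bad := [seq (L x @^-1: W' h)%VS | h <- enum (A :&: [set h | x \in J h])].
have [||c cP] := @avoid_subspaces F U bad.
- rewrite size_map -cardE; apply: leq_ltn_trans ltAF.
  by rewrite subset_leq_card ?subsetIl.
- apply/allP=> W1 /mapP[h]; rewrite mem_enum !inE => /andP[hA xJ] ->.
  have [vW _] := W'P h hA xJ; apply: contra vW => /eqP full.
  by rewrite memv_preim full memvf.
exists (fun j => if j == x then c else b j) => h hA.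
have [xJ|xJ] := boolP (x \in J h); last first.
  rewrite -bP //; congr (\dim (_ + _)%VS); apply: eq_bigr => j jJ.
  by rewrite inE; have /negPf-> : j != x by apply: contraNneq xJ => <-.
have [_ dW'] := W'P h hA xJ.
rewrite sumD1 // inE eqxx /= dimv_add_line.
have -> : (\sum_(j in J h | j != x) <[L j (if j \in x :: s then
    if j == x then c else b j else b0 h j)]> = \sum_(j in J h | j != x) <[v h j]>)%VS.
  by apply: eq_bigr => j /andP[_ /negPf jx]; rewrite inE jx.
rewrite -/(W' h) dW'.
have -> : L x c \notin W' h.
  rewrite memv_preim; apply: (allP cP); apply/mapP; exists h => //.
  by rewrite mem_enum !inE hA.
by rewrite /= addn1 prednK // (cardsD1 x) xJ; lia.
Qed.

(** * The rank function of the family scheme *)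

Lemma half_ltn (n i : nat) : (i < n)%N -> (i./2 < n)%N.
Proof. lia. Qed.

(** The family index counted from 0 and valued in a finite type, so that images of node sets have a
    cardinality. *)
Definition family_of (n : nat) (i : 'I_n) : 'I_n := Ordinal (half_ltn (ltn_ord i)).

Lemma FI_eq (n : nat) (i j : 'I_n) : (FI i == FI j) = (family_of i == family_of j).
Proof. by rewrite /FI eqSS. Qed.

(* #|S| - #|family_of @: S| counts the families contained in S, so that,     *)
(* adding the nodes of S one by one, a node contributes d minus the number of *)
(* its predecessors in other families, as in bvec.                            *)
Definition cut (n d : nat) (S : {set 'I_n}) : nat :=
  (\sum_(i < #|S|) (d - i) + (#|S| - #|@family_of n @: S|))%N.

Definition rank_fun (n d M : nat) (S : {set 'I_n}) : nat := minn M (cut d S).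

Lemma cutU1 (n d : nat) (x : 'I_n) (S : {set 'I_n}) : x \notin S ->
  cut d (x |: S) =
  (cut d S + (d - #|S|) + (family_of x \in @family_of n @: S))%N.
Proof.
move=> xS; rewrite /cut imsetU1 !cardsU1 xS add1n big_ord_recr /=.
have := leq_imset_card (@family_of n) S.
move: #|@family_of n @: S| => c; move: #|S| => s; move: (\sum_(_ < _) _)%N => g.
by case: (family_of x \in _) => /=; lia.
Qed.

Lemma cut_mono (n d : nat) (A B : {set 'I_n}) :
  A \subset B -> (cut d A <= cut d B)%N.
Proof.
apply: set_monotone => x S; have [xS|xS] := boolP (x \in S).
  by rewrite (setUidPr _) ?sub1set.
by rewrite cutU1 // -addnA leq_addr.
Qed.

Lemma rank_fun_le (n d M : nat) (S : {set 'I_n}) : (rank_fun d M S <= M)%N.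
Proof. exact: geq_minl. Qed.

Lemma rank_fun_mono (n d M : nat) (A B : {set 'I_n}) :
  A \subset B -> (rank_fun d M A <= rank_fun d M B)%N.
Proof. by move=> /(cut_mono d); rewrite /rank_fun; lia. Qed.

(** Once a set has d nodes the terms d - i are used up, and [cut] may stop being submodular; here
    the truncation at M takes over. *)
Definition large_cuts (n d M : nat) : Prop :=
  forall S : {set 'I_n}, (d < #|S|)%N -> (M <= cut d S)%N.

(** A new node x adds d - |S|, truncated at 0, plus one if its family mate is in S. When A grows to
    a larger B, the first term drops by at least one if |A| < d, which pays for a mate gained;
    otherwise |B| > d and the rank of B is already M. *)
Lemma rank_fun_polymatroid (n d M : nat) :
  large_cuts n d M -> polymatroid (@rank_fun n d M).
Proof.
move=> satM; apply: polymatroid_local => [|x S|x A B sAB xB].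
- by rewrite /rank_fun /cut imset0 !cards0 big_ord0 minn0.
- by rewrite rank_fun_mono ?subsetUr.
have xA : x \notin A by apply: contra xB; apply: subsetP.
have := cut_mono d sAB; have := satM B.
rewrite /rank_fun !cutU1 //.
have [eAB|neAB] := eqVneq A B; first by rewrite eAB; lia.
have : (#|A| < #|B|)%N by rewrite proper_card // properEneq neAB.
case: (family_of x \in _); case: (family_of x \in _) => /=; lia.
Qed.

(** A mate of x in S adds one to the increment but is not counted among the nodes of S outside the
    family. For |S| > d both ranks are M. *)
Lemma rank_funU1_le (n d M : nat) (x : 'I_n) (S : {set 'I_n}) :
  large_cuts n d M -> x \notin S ->
  (rank_fun d M (x |: S) <=
   rank_fun d M S + (d - #|[set y in S | FI y != FI x]|))%N.
Proof.
move=> satM xS; have := satM S; rewrite /rank_fun cutU1 //.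
suff : (#|[set y in S | FI y != FI x]| + (family_of x \in @family_of n @: S) <= #|S|)%N.
  set D := [set y in S | _]; move: #|D| #|S| (cut d S) => a b c.
  by case: (family_of x \in _) => /= ab; case: (leqP b d) => bd => [_|/(_ isT)]; lia.
have [/imsetP[y yS xy]|_] := boolP (family_of x \in _); last first.
  by rewrite addn0 subset_leq_card //; apply/subsetP=> z; rewrite inE => /andP[].
rewrite (cardsD1 y S) yS addnC leq_add2l subset_leq_card //.
apply/subsetP=> z; rewrite !inE => /andP[-> ]; rewrite andbT.
by apply: contraNneq => ->; rewrite FI_eq xy.
Qed.

Lemma card_ltn_ord (m n : nat) : (m <= n)%N -> #|[set j : 'I_n | (j < m)%N]| = m.
Proof.
move=> le_mn; rewrite -[RHS]card_ord -sum1_card -[RHS]sum1_card.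
by rewrite (big_ord_widen _ (fun=> 1%N) le_mn); apply: eq_bigl => j; rewrite inE.
Qed.

(** Only position i - n/2 can carry the same family index earlier. A lower bound on y_i is enough,
    as the file size is to be bounded from above. *)
Lemma num_diff_rfip (n : nat) (i : 'I_n) : (n %% 2 = 0)%N ->
  (i <= num_diff_before (@rfip n) i + (n./2 <= i))%N.
Proof.
move=> n_even.
have rfipE (j : 'I_n) : rfip j = (if (j < n./2)%N then j.+1 else (j - n./2).+1)%N.
  have := ltn_ord j; rewrite /rfip nth_cat size_iota.
  by move=> jn; case: (ltnP j n./2) => h; rewrite nth_iota ?add1n //; lia.
rewrite -[X in (X <= _)%N](card_ltn_ord (ltnW (ltn_ord i))) /num_diff_before.
rewrite -[X in (X <= _)%N](cardsID [set j : 'I_n | rfip j != rfip i]).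
apply: leq_add; first by apply: subset_leq_card; apply/subsetP=> j; rewrite !inE.
set D := _ :\: _; have DP (j : 'I_n) : j \in D -> (n./2 <= i)%N /\ (j = i - n./2 :> nat)%N.
  rewrite !inE negbK !rfipE => /andP[/eqP e ji].
  by move: e; case: (ltnP j n./2); case: (ltnP i n./2); lia.
have D1 : (#|D| <= 1)%N.
  apply/card_le1_eqP => x y /DP[_ ex] /DP[_ ey].
  by apply: val_inj; rewrite /= ex ey.
case: (posnP #|D|) => [->//|/card_gt0P[j /DP[-> _]]] //.
Qed.

Lemma card_family_le (n : nat) (S : {set 'I_n}) : (n %% 2 = 0)%N ->
  (#|@family_of n @: S| <= n./2)%N.
Proof.
move=> n_even; have [n0|n_gt0] := posnP n.
  by apply: leq_trans (leq_imset_card _ _) _; rewrite (leq_trans (max_card _)) // card_ord n0.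
have hn : (n./2 < n)%N by lia.
rewrite -[n./2](card_ltn_ord (ltnW hn)) subset_leq_card //.
apply/subsetP=> _ /imsetP[x _ ->]; rewrite inE /=.
by have := ltn_ord x; lia.
Qed.

(** A set S meets at most n/2 families, so it contains at least |S| - n/2 full ones, the number of
    repetitions in the first |S| entries of the rotating permutation. The case |S| >= k serves
    reconstruction, the case |S| > d serves [large_cuts]. *)
Lemma file_size_le_cut (n k d M : nat) (S : {set 'I_n}) :
  (k <= n)%N -> (n %% 2 = 0)%N -> M%:Z = file_size n k d ->
  (k <= #|S|)%N || (d < #|S|)%N -> (M <= cut d S)%N.
Proof.
move=> k_le_n n_even M_def kS.
(* The condition i <= d makes v vanish beyond d, where d - y_i is at most 0; hence stopping at |S| <
   k loses nothing when |S| > d. *)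
pose v i := ((d - i) + ((n./2 <= i) && (i <= d)))%N.
have Mv : (M <= \sum_(i < k) v i)%N.
  rewrite -lez_nat M_def /file_size (big_ord_widen _ _ k_le_n) -[X in (_ <= X)%R]natz natr_sum.
  apply: ler_sum => i _; rewrite natz; have := num_diff_rfip i n_even; rewrite /v; lia.
have vS : (\sum_(i < k) v i <= \sum_(i < #|S|) v i)%N.
  have [le_kS|lt_Sk] := leqP k #|S|.
    rewrite (big_ord_widen _ _ le_kS) big_mkcond /=.
    by apply: leq_sum => i _; case: ifP.
  rewrite (big_ord_widen _ _ (ltnW lt_Sk)) [X in (_ <= X)%N]big_mkcond /=.
  apply: leq_sum => i _; case: ltnP => // Si; move: kS.
  rewrite leqNgt lt_Sk /= /v; lia.
apply: leq_trans Mv (leq_trans vS _).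
have sum_le s : (\sum_(i < s) v i <= \sum_(i < s) (d - i) + (s - n./2))%N.
  elim: s => [|s IH]; first by rewrite !big_ord0.
  rewrite !big_ord_recr /=; move: IH.
  move: (\sum_(i < s) v i)%N (\sum_(i < s) (d - i))%N => a b; rewrite /v.
  by case: (leqP n./2 s); case: (leqP s d) => /=; lia.
apply: leq_trans (sum_le _) _; rewrite leq_add2l leq_sub2l //.
exact: card_family_le.
Qed.

(** * Independent vectors lie in H *)

Lemma sumn_take_enum (n m : nat) (a : 'I_n -> nat) :
  sumn (take m [seq a i | i <- enum 'I_n]) = (\sum_(i < n | i < m) a i)%N.
Proof.
pose a' j := if insub j is Some i then a i else 0%N.
have aE (i : 'I_n) : a i = a' i by rewrite /a' valK.
rewrite (eq_map aE) (map_comp a' val) val_enum_ord -map_take take_iota.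
under [RHS]eq_bigr do rewrite aE.
rewrite sumnE big_map -[minn m n]subn0 (big_mkord xpredT a') (big_ord_widen _ a' (geq_minr m n)).
by apply: eq_bigl => i; rewrite leq_min ltn_ord andbT.
Qed.

(* With v the entry at position m, both sides are controlled by the symmetric *)
(* expression m * v + \sum_(x <- s) (x - v).                                  *)
Lemma sumn_take_le_sort (s : seq nat) (m : nat) :
  (sumn (take m s) <= sumn (take m (sort geq s)))%N.
Proof.
have [le_sm|lt_ms] := leqP (size s) m.
  rewrite !take_oversize ?size_sort // (perm_sumn (s2 := s)) //.
  by rewrite perm_sort.
set t := sort geq s; have st : perm_eq t s by rewrite perm_sort.
have lt_mt : (m < size t)%N by rewrite size_sort.
pose v := nth 0%N t m; pose ex (r : seq nat) := (\sum_(x <- r) (x - v))%N.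
have ub : (sumn (take m s) <= m * v + ex s)%N.
  rewrite -{2}(cat_take_drop m s) /ex big_cat /= addnA.
  apply: leq_trans (leq_addr _ _).
  have -> : (m * v = \sum_(x <- take m s) v)%N.
    by rewrite big_const_seq count_predT size_takel ?(ltnW lt_ms) // iter_addn_0 mulnC.
  by rewrite sumnE -big_split /=; apply: leq_sum => x _; lia.
apply: leq_trans ub _; rewrite /ex -(perm_big _ st) /=.
have geqT : transitive geq by move=> x y z /= xy /leq_trans; apply.
have := sorted_pairwise geqT t; rewrite sort_sorted; last first.
  by move=> x y; rewrite /= leq_total.
rewrite -[X in pairwise _ X](cat_take_drop m t) (drop_nth 0%N lt_mt) -/v.
rewrite pairwise_cat /= => /esym/andP[/allrelP le_v /andP[_ /andP[/allP v_ge _]]].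
rewrite -{1}(cat_take_drop m t) (drop_nth 0%N lt_mt) -/v big_cat big_cons /= subnn.
rewrite [X in (_ + (_ + (_ + X)) <= _)%N]big_seq.
rewrite [X in (_ + (_ + (_ + X)) <= _)%N]big1 => [|x /v_ge /= xv]; last by lia.
rewrite !addn0.
have -> : (m * v = \sum_(x <- take m t) v)%N.
  by rewrite big_const_seq count_predT size_takel ?(ltnW lt_mt) // iter_addn_0 mulnC.
rewrite sumnE -big_split /= big_seq [X in (_ <= X)%N]big_seq.
apply: leq_sum => x xt; have := le_v x v xt; rewrite inE eqxx /= => /(_ isT); lia.
Qed.

Lemma rank_fun_prefix (n d M m : nat) (pi : 'S_n) :
  large_cuts n d M -> (m <= n)%N ->
  (rank_fun d M (pi @: [set i : 'I_n | i < m]) <=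
   \sum_(i < n | i < m) bvec d pi i)%N.
Proof.
move=> satM; elim: m => [|m IH] lt_mn.
  rewrite (_ : [set i | _] = set0); last by apply/setP=> i; rewrite !inE.
  by have [rho0 _ _] := rank_fun_polymatroid satM; rewrite imset0 rho0.
pose x := Ordinal lt_mn.
have -> : [set i : 'I_n | (i < m.+1)%N] = x |: [set i : 'I_n | (i < m)%N].
  by apply/setP=> i; rewrite !inE ltnS leq_eqVlt.
rewrite imsetU1; set S := pi @: _.
have xS : pi x \notin S by rewrite mem_imset ?inE ?ltnn //; apply: perm_inj.
apply: leq_trans (rank_funU1_le satM xS) _.
rewrite [X in (_ <= X)%N](bigD1 x) //= addnC leq_add //.
  rewrite /bvec leq_sub2l // /num_diff_before.
  rewrite -(card_imset _ (@perm_inj _ pi)) subset_leq_card //.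
  apply/subsetP=> y /imsetP[j]; rewrite !inE => /andP[jm jx] ->.
  by rewrite jx andbT; apply: imset_f; rewrite inE.
apply: leq_trans (IH (ltnW lt_mn)) _; apply: eq_leq; apply: eq_bigl => i.
by rewrite ltnS -val_eqE /=; case: ltngtP.
Qed.

(** Before the cut index c equals b, and the entry at the cut index completes the sum to M. As m <
    n, the default value n of [cut_index] falls under the first case. *)
Lemma cvec_prefix (n d M m : nat) (pi : 'S_n) : (m < n)%N ->
  (minn M (\sum_(i < n | i < m.+1) bvec d pi i) <=
   \sum_(i < n | i < m.+1) cvec d M pi i)%N.
Proof.
move=> lt_mn; set c := cut_index d M pi.
have [lt_mc|le_cm] := ltnP m c.
  apply: leq_trans (geq_minr _ _) _; apply: eq_leq; apply: eq_bigr => i im.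
  by rewrite /cvec -/c (leq_trans im lt_mc).
apply: leq_trans (geq_minl _ _) _.
have lt_cn := leq_ltn_trans le_cm lt_mn; pose x := Ordinal lt_cn.
rewrite (bigD1 x) //= {1}/cvec -/c ltnn eqxx.
have : (\sum_(j < n | j < c) bvec d pi j <=
        \sum_(i < n | (i < m.+1) && (i != x)) cvec d M pi i)%N.
  rewrite big_mkcond [X in (_ <= X)%N]big_mkcond /=; apply: leq_sum => i _.
  rewrite -val_eqE /=; case: ltnP => // ic; rewrite /cvec -/c ic.
  by rewrite (leq_trans ic) ?(leq_trans le_cm) // neq_ltn ic.
by move=> le_b; apply: leq_trans (leq_add (leqnn _) le_b); rewrite addnC -leq_subLR.
Qed.

Definition independent_vectors (n d M : nat) : {set {ffun 'I_n -> 'I_d.+1}} :=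
  [set h : {ffun 'I_n -> 'I_d.+1} | independent (@rank_fun n d M) (fun i => h i)].

(** Let pi sort h in decreasing order. The sum of the m largest entries is h of a set of m nodes,
    hence at most its rank, which is at most M and at most the prefix sum of b; so it is bounded by
    the prefix sum of c, and so by the m largest entries of c. *)
Lemma independent_vectors_sub (n d M : nat) : large_cuts n d M ->
  independent_vectors n d M \subset Hset n d M.
Proof.
move=> satM; apply/subsetP=> h; rewrite !inE => /forallP hP.
pose t := [tuple (h i : nat) | i < n].
have /tuple_permP[pi t_pi] : perm_eq (sort geq t) t by rewrite perm_sort.
have sortE : sort geq [seq (h i : nat) | i <- enum 'I_n] =
             [seq (h (pi i) : nat) | i <- enum 'I_n].
  rewrite -[LHS]/(sort geq t) t_pi /=; apply: eq_map => i; exact: tnth_mktuple.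
have geqT : transitive geq by move=> x y z /= xy /leq_trans; apply.
have h_sorted : sorted geq [seq (h (pi i) : nat) | i <- enum 'I_n].
  by rewrite -sortE sort_sorted // => x y; rewrite /= leq_total.
apply/existsP; exists pi; apply/andP; split.
  suff hs (i j : 'I_n) : j = i.+1 :> nat -> (h (pi j) <= h (pi i))%N.
    by apply/forallP=> i; apply/forallP=> j; apply/implyP=> /eqP /hs.
  move=> ji; have szP (l : 'I_n) : (l : nat) \in
      [pred l | (l < size [seq (h (pi i) : nat) | i <- enum 'I_n])%N].
    by rewrite inE size_map size_enum_ord.
  have lt_ij : (i < j)%N by rewrite ji.
  have := sorted_ltn_nth geqT 0%N h_sorted _ _ (szP i) (szP j) lt_ij.
  have nthE (l : 'I_n) : nth 0%N [seq (h (pi i) : nat) | i <- enum 'I_n] l = h (pi l).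
    by rewrite (nth_map i) ?size_enum_ord // nth_ord_enum.
  by rewrite !nthE.
apply/forallP=> m; rewrite /sum_largest sortE sumn_take_enum.
apply: leq_trans (sumn_take_le_sort _ _); rewrite sumn_take_enum.
apply: leq_trans (cvec_prefix _ _ _ (ltn_ord m)).
have -> : (\sum_(i < n | i < m.+1) h (pi i) =
           \sum_(x in pi @: [set i : 'I_n | i < m.+1]) h x)%N.
  rewrite big_imset /=; last by move=> x y _ _; apply: perm_inj.
  by apply: eq_bigl => i; rewrite inE.
apply: leq_trans (hP _) _; rewrite leq_min rank_fun_le /=.
exact: rank_fun_prefix.
Qed.

(** * Exchange at a repair, and bases *)

Lemma independent_ord (n d M : nat) (h : 'I_n -> nat) :
  independent (@rank_fun n d M) h -> forall i, (h i <= d)%N.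
Proof.
move=> /forallP hP i; have := hP [set i]; rewrite big_set1.
move/leq_trans; apply; rewrite /rank_fun /cut imset_set1 !cards1.
by rewrite big_ord1 subn0 addn0 geq_minr.
Qed.

(** Reset h at f and raise it maximally by at most one on X, giving g, raised on J, with tight set
    S; put T = S minus f. All of X outside T is raised. With e the number of nodes of T outside the
    family of f, h(T) + h_f <= rho(T) + (d - e) and rho(T) <= g(T) = h(T) + |J :&: T|. As X avoids
    that family, d - e <= |X :\: T|, whence h_f <= |J|; any h_f elements of J will do. *)
Lemma independent_repair (n d M : nat) (h : 'I_n -> nat) (f : 'I_n)
    (X : {set 'I_n}) :
  large_cuts n d M -> independent (@rank_fun n d M) h ->
  X \subset helper_candidates f -> #|X| = d ->
  exists J : {set 'I_n}, [/\ J \subset X, #|J| = h f &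
    independent (@rank_fun n d M)
      (fun i => (if i == f then 0 else h i) + (i \in J))%N].
Proof.
move=> satM hP sX cX.
have rhoP := rank_fun_polymatroid satM.
pose h0 i := (if i == f then 0 else h i)%N.
have h0P : independent (@rank_fun n d M) h0.
  by apply: independent_le hP => i; rewrite /h0; case: eqP.
have fX : f \notin X.
  by apply/negP => /(subsetP sX); rewrite inE eqxx.
have [g [S [gP g_ge g_le] [gS gN]]] :=
  independent_maximal (fun i => (i \in X : nat)) rhoP h0P.
pose J := [set i in X | (h0 i < g i)%N].
have gE i : g i = (h0 i + (i \in J))%N.
  have := g_ge i; have := g_le i; rewrite inE.
  by case: (i \in X) => /=; case: ltnP => /=; lia.
pose T := S :\ f.
have fT : f \notin T by rewrite !inE eqxx.
have gf0 : g f = 0%N by rewrite gE /h0 eqxx inE (negPf fX).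
have sum_T : (\sum_(i in T) g i = \sum_(i in S) g i)%N.
  have [fS|fS] := boolP (f \in S); last first.
    suff -> : T = S by [].
    by apply/setP=> i; rewrite !inE; case: eqP => // ->; rewrite (negPf fS).
  by rewrite [RHS](big_setD1 f) //= gf0.
have gT : (rank_fun d M T <= \sum_(i in T) g i)%N.
  by rewrite sum_T gS rank_fun_mono ?subsetDl.
have XTJ : X :\: T \subset J.
  apply/subsetP=> i; rewrite !inE => /andP[iT iX].
  have nif : i != f by apply: contraNneq fX => <-.
  move: iT; rewrite nif /= => /gN; rewrite iX addn1 => ->.
  by rewrite ltnS leqnn.
have hJ : (h f <= #|J|)%N.
  have := forallP hP (f |: T).
  rewrite big_setU1 //=.
  have -> : (\sum_(i in T) h i = \sum_(i in T) h0 i)%N.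
    by apply: eq_bigr => i iT; rewrite /h0; case: eqP iT fT => [-> ->|].
  have := rank_funU1_le satM fT; move: gT.
  rewrite (eq_bigr _ (fun i _ => gE i)) big_split /=.
  have -> : (\sum_(i in T) (i \in J) = #|J :&: T|)%N.
    rewrite -sum1_card [LHS]big_mkcond [RHS]big_mkcond /=; apply: eq_bigr => i _.
    by rewrite in_setI andbC; case: (i \in T); case: (i \in J).
  have : (d <= #|X :\: T| + #|[set y in T | FI y != FI f]|)%N.
    rewrite -cX -(cardsID T X) addnC leq_add2l subset_leq_card //.
    apply/subsetP=> y; rewrite !inE => /andP[yX ->] /=.
    by have := subsetP sX y yX; rewrite inE.
  have : (#|X :\: T| + #|J :&: T| <= #|J|)%N.
    rewrite -(cardsID T J) addnC leq_add2l subset_leq_card //.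
    by apply/subsetP=> y yXT; rewrite inE (subsetP XTJ) // andbT; case/setDP: yXT.
  set a := #|J|; set b := #|X :\: T|; set c := #|J :&: T|.
  set e := #|[set y in T | _]|; lia.
have : (0 < #|[set B : {set 'I_n} | (B \subset J) && (#|B| == h f)]|)%N.
  by rewrite cards_draws bin_gt0.
case/card_gt0P=> B; rewrite inE => /andP[sBJ /eqP cB]; exists B; split=> //.
  by apply: subset_trans sBJ _; apply/subsetP=> i; rewrite inE => /andP[].
apply: independent_le gP => i; rewrite gE leq_add2l.
by case: (boolP (i \in B)) => // /(subsetP sBJ) ->.
Qed.

(** Raise 0 with cap M on K and 0 elsewhere. Either the tight set contains K and has rank M, or a
    node of K outside it has reached the cap M alone. *)
Lemma independent_base (n d M : nat) (K : {set 'I_n}) :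
  large_cuts n d M -> (M <= cut d K)%N ->
  exists h : 'I_n -> nat,
    [/\ independent (@rank_fun n d M) h, forall i, i \notin K -> h i = 0%N
      & (\sum_i h i)%N = M].
Proof.
move=> satM KM; have rhoP := rank_fun_polymatroid satM.
have h0P : independent (@rank_fun n d M) (fun=> 0%N).
  by apply/forallP=> S; rewrite big1.
have [h [S [hP _ h_le] [hS hN]]] :=
  independent_maximal (fun i => ((i \in K) * M)%N) rhoP h0P.
exists h; split=> //.
  by move=> i /negPf iK; have := h_le i; rewrite iK; lia.
apply/eqP; rewrite eqn_leq; apply/andP; split.
  have := forallP hP setT; rewrite (eq_bigl xpredT) => [|i]; last by rewrite inE.
  by move/leq_trans; apply; apply: rank_fun_le.
have [sKS|/subsetPn[i iK iS]] := boolP (K \subset S).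
  have -> : M = rank_fun d M K by apply/esym/minn_idPl.
  apply: leq_trans (rank_fun_mono d M sKS) _; rewrite -hS.
  by rewrite [X in (_ <= X)%N](bigID (mem S)) leq_addr.
by rewrite (bigD1 i) //= (hN i iS) iK mul1n leq_addr.
Qed.

(** * Codes and repairs *)

Definition prefix_span (F : fieldType) (n M d : nat) (Q : code F n M d)
    (h : 'I_n -> nat) : {vspace 'cV[F]_M} :=
  (\sum_(i < n) \sum_(l < d | (l < h i)%N) <[col l (Q i)]>)%VS.

Definition good_code (F : fieldType) (n M d : nat) (Q : code F n M d) : bool :=
  [forall h in independent_vectors n d M,
     \dim (prefix_span Q (fun i => h i)) == (\sum_i h i)%N].

Lemma good_codeP (F : fieldType) (n M d : nat) (Q : code F n M d)
    (h : 'I_n -> nat) :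
  good_code Q -> independent (@rank_fun n d M) h ->
  \dim (prefix_span Q h) = (\sum_i h i)%N.
Proof.
move=> Qgood hP; pose h' : {ffun 'I_n -> 'I_d.+1} := [ffun i => inord (h i)].
have hE i : h i = h' i by rewrite ffunE inordK // ltnS (independent_ord hP).
have /eqP : \dim (prefix_span Q (fun i => h' i)) == (\sum_i h' i)%N.
  apply: (forall_inP Qgood); rewrite inE.
  by apply: independent_le hP => i; rewrite -hE.
rewrite (eq_bigr _ (fun i _ => hE i)) => <-; congr (\dim _).
by apply: eq_bigr => i _; rewrite hE.
Qed.

(** Supplies the hypothesis of [common_choice] from a subspace whose dimension is already known. *)
Lemma dimv_add_lines_eq (F : fieldType) (V : vectType F) (I : finType)
    (W X : {vspace V}) (J : {set I}) (v : I -> V) :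
  (X <= W + \sum_(j in J) <[v j]>)%VS -> (\dim W + #|J| <= \dim X)%N ->
  \dim (W + \sum_(j in J) <[v j]>) = (\dim W + #|J|)%N.
Proof.
move=> sX dX; apply/eqP; rewrite eqn_leq dimv_add_lines /=.
exact: leq_trans dX (dimvS sX).
Qed.

Lemma mul_col_delta (F : fieldType) (m p : nat) (A : 'M[F]_(m, p)) (l : 'I_p) :
  A *m (\col_(u < p) (u == l :> nat)%:R) = col l A.
Proof. by rewrite colE; congr (_ *m _); apply/colP=> u; rewrite !mxE andbT. Qed.

Lemma dimv_full_col (F : fieldType) (M : nat) :
  \dim (fullv : {vspace 'cV[F]_M}) = M.
Proof. by rewrite dimvf dim_matrix; apply: muln1. Qed.

Lemma dim_col_delta (F : fieldType) (I : finType) (M : nat) (J : {set I}) :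
  (#|J| <= M)%N ->
  \dim (0 + \sum_(j in J) <[(\col_(u < M) (u == index j (enum J) :> nat)%:R : 'cV[F]_M)]>)%VS
  = (\dim (0 : {vspace 'cV[F]_M}) + #|J|)%N.
Proof.
move=> le_JM; pose v j : 'cV[F]_M := \col_(u < M) (u == index j (enum J) :> nat)%:R.
rewrite -[LHS]/(\dim (0 + \sum_(j in J) <[v j]>)%VS).
apply/eqP; rewrite eqn_leq dimv_add_lines dimv0 add0n /=.
pose D := (\sum_(j in J) <[v j]>)%VS.
pose P (u : 'I_M) := ~~ (u < #|J|)%N.
have full : (fullv <= D + \sum_(u | P u) <[(delta_mx u 0)%R : 'cV[F]_M]>)%VS.
  apply/subvP=> w _; rewrite (matrix_sum_delta w).
  apply: memv_suml => u _; rewrite big_ord1 memvZ //.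
  have [uJ|uJ] := boolP (P u).
    apply: (subvP (addvSr _ _)); apply: (subvP (sumv_sup u uJ (subvv _))).
    exact: memv_line.
  move: uJ; rewrite negbK => uJ; apply: (subvP (addvSl _ _)).
  have [x0 _] : exists x0, x0 \in J.
    by apply/card_gt0P; apply: leq_ltn_trans uJ.
  have jJ : nth x0 (enum J) u \in J by rewrite -mem_enum mem_nth -?cardE.
  apply: (subvP (sumv_sup _ jJ (subvv _))).
  suff -> : delta_mx u 0 = v (nth x0 (enum J) u) by apply: memv_line.
  by apply/colP=> y; rewrite !mxE andbT index_uniq ?enum_uniq -?cardE.
have := leq_trans (dimvS full) (dimv_add_lines _ _ _).
rewrite dimv_full_col add0v -/D.
have -> : #|P| = (M - #|J|)%N.
  rewrite -[in RHS](card_ord M) -(cardsC [set u : 'I_M | (u < #|J|)%N]).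
  by rewrite card_ltn_ord // addKn; apply: eq_card => u; rewrite !inE.
by rewrite addnC -leq_subLR subKn.
Qed.

(** For a single h the sum of h is at most M, so distinct unit vectors serve as its columns;
    [common_choice], indexed by pairs of a node and a column, makes them common to all h. *)
Lemma good_code_init (F : finFieldType) (n M d : nat) :
  (#|independent_vectors n d M| < #|F|)%N ->
  exists Q : code F n M d, good_code Q.
Proof.
move=> lt_F.
pose J (h : {ffun 'I_n -> 'I_d.+1}) := [set p : 'I_n * 'I_d | (p.2 < h p.1)%N].
have cJ h : #|J h| = (\sum_i h i)%N.
  rewrite -sum1_card (eq_bigl (fun p : 'I_n * 'I_d => (p.2 < h p.1)%N)); last first.
    by move=> p; rewrite inE.
  rewrite -(pair_big_dep xpredT (fun i (l : 'I_d) => (l < h i)%N) (fun _ _ => 1%N)) /=.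
  apply: eq_bigr => i _; have hi : (h i <= d)%N by rewrite -ltnS.
  by rewrite -(big_ord_widen _ (fun=> 1%N) hi) sum1_card card_ord.
have [||b bP] := @common_choice F 'cV[F]_M 'cV[F]_M ('I_n * 'I_d)%type
    {ffun 'I_n -> 'I_d.+1} (fun=> \1%VF) (independent_vectors n d M) (fun=> 0%VS) J
    (fun h p => \col_(u < M) (u == index p (enum (J h)) :> nat)%:R).
- exact: lt_F.
- move=> h; rewrite inE => /forallP hP; under eq_bigr do rewrite id_lfunE.
  apply: dim_col_delta; rewrite cJ; have := hP setT.
  rewrite (eq_bigl xpredT) => [|i]; last by rewrite inE.
  by move/leq_trans; apply; apply: rank_fun_le.
exists (fun i => \matrix_(u, l) b (i, l) u 0); apply/forall_inP=> h hA.
have := bP h hA; rewrite dimv0 add0n cJ add0v => <-; apply/eqP; congr (\dim _).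
rewrite /prefix_span pair_big_dep /=; apply: eq_big => [[i l]|[i l] _] /=.
  by rewrite inE.
by rewrite id_lfunE; congr (<[_]>)%VS; apply/colP=> u; rewrite !mxE.
Qed.

(** A copy of [repair_choice] in a finite type, so that a choice can be searched for by [pick]. *)
Definition finite_choice (F : finFieldType) (d : nat) :=
  ({ffun 'I_d -> 'cV[F]_d} * 'M[F]_d)%type.

Definition choice_of (F : finFieldType) (d : nat) (c : finite_choice F d) :
  repair_choice F d := (fun j => c.1 j, c.2).

Lemma good_code_repair (F : finFieldType) (n M d : nat) (Q : code F n M d)
    (e : event n d) :
  large_cuts n d M -> (#|independent_vectors n d M| < #|F|)%N ->
  good_code Q -> valid_event e ->
  exists c : finite_choice F d, good_code (repair Q e (choice_of c)).
Proof.
move=> satM lt_F Qgood /andP[x_uniq /allP x_cand].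
set f := e.1; pose x j := tnth e.2 j.
have x_inj : injective x by apply/tuple_uniqP.
have xf j : x j != f.
  have := x_cand _ (mem_tnth j e.2); rewrite /= inE -/(x j).
  by apply: contraNneq => ->.
pose X := [set x j | j in 'I_d].
have sX : X \subset helper_candidates f.
  by apply/subsetP=> _ /imsetP[j _ ->]; apply: x_cand; apply: mem_tnth.
have cX : #|X| = d by rewrite card_imset // card_ord.
pose A := independent_vectors n d M.
pose h0 (h : {ffun 'I_n -> 'I_d.+1}) (i : 'I_n) := (if i == f then 0 else h i)%N.
pose h1 h (J : {set 'I_d}) (i : 'I_n) := (h0 h i + (i \in x @: J))%N.
have exJ h : h \in A -> exists J : {set 'I_d},
    (#|J| == h f) && independent (@rank_fun n d M) (h1 h J).
  rewrite inE => hP; have [J [sJX cJ JP]] := independent_repair satM hP sX cX.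
  have xJ : x @: (x @^-1: J) = J.
    apply/setP=> i; apply/imsetP/idP => [[j]|iJ]; first by rewrite inE => jJ ->.
    by have /imsetP[j _ ij] := subsetP sJX i iJ; exists j; rewrite // inE -ij.
  exists (x @^-1: J); rewrite -(card_imset _ x_inj) xJ cJ eqxx.
  by rewrite /h1 xJ.
pose J (h : {ffun 'I_n -> 'I_d.+1}) := odflt set0 [pick J : {set 'I_d} |
    (#|J| == h f) && independent (@rank_fun n d M) (h1 h J)].
have JP h : h \in A -> #|J h| = h f /\ independent (@rank_fun n d M) (h1 h (J h)).
  move=> hA; rewrite /J; case: pickP => [K /andP[/eqP-> KP] //|no].
  by have [K] := exJ h hA; rewrite no.
pose W (h : {ffun 'I_n -> 'I_d.+1}) :=
  (\sum_(i < n | i != f) \sum_(l < d | (l < h i)%N) <[col l (Q i)]>)%VS.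
have WE h : W h = prefix_span Q (h0 h).
  rewrite /prefix_span (bigD1 f) //= big_pred0 => [|l]; last by rewrite /h0 eqxx.
  rewrite add0v; apply: eq_bigr => i /negPf nif; apply: eq_bigl => l.
  by rewrite /h0 nif.
have dimW h : h \in A -> \dim (W h) = (\sum_i h0 h i)%N.
  rewrite inE => hP; rewrite WE; apply: good_codeP => //.
  by apply: independent_le hP => i; rewrite /h0; case: eqP.
have sum_h1 h : (\sum_i h1 h (J h) i = \sum_i h0 h i + #|J h|)%N.
  rewrite big_split /= -(card_imset _ x_inj); congr addn.
  by rewrite -sum1_card [RHS]big_mkcond; apply: eq_bigr => i _; case: (i \in _).
have [b bP] : exists b : 'I_d -> 'cV[F]_d, {in A, forall h,
    \dim (W h + \sum_(j in J h) <[linfun (mulmx (Q (x j))) (b j)]>) =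
    (\dim (W h) + #|J h|)%N}.
  (* For one h, the unit vector of index h (x j) extracts the column of helper x j that follows its
     prefix, columns being counted from 0. *)
  apply: (@common_choice F 'cV[F]_M 'cV[F]_d 'I_d _
    (fun j => linfun (mulmx (Q (x j)))) A W J
    (fun h j => \col_(u < d) (u == h (x j) :> nat)%:R)) => // h hA.
  have [_ hJ] := JP h hA.
  apply: (dimv_add_lines_eq (X := prefix_span Q (h1 h (J h)))); last first.
    by rewrite (good_codeP Qgood hJ) sum_h1 dimW.
  apply/subv_sumP=> i _; apply/subv_sumP=> l; rewrite -memvE => l_lt.
  have [lh|lh] := ltnP l (h0 h i).
    apply: (subvP (addvSl _ _)); rewrite WE.
    apply: (subvP (sumv_sup i isT (subvv _))).
    by apply: (subvP (sumv_sup l lh (subvv _))); apply: memv_line.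
  apply: (subvP (addvSr _ _)); move: l_lt; rewrite /h1.
  case: imsetP => [[j jJ ij]|_]; last by rewrite addn0 ltnNge lh.
  rewrite addn1 ltnS => hl; apply: (subvP (sumv_sup j jJ (subvv _))).
  have lE : (l = h (x j) :> nat)%N.
    by apply/eqP; rewrite eqn_leq -ij; move: lh hl; rewrite /h0 ij (negPf (xf j)) => -> ->.
  by rewrite -lE lfunE /= mul_col_delta -ij memv_line.
pose B := \matrix_(u < M, j < d) (Q (x j) *m b j) u 0.
have colB j : col j B = Q (x j) *m b j by apply/colP=> u; rewrite !mxE.
have hd (h : {ffun 'I_n -> 'I_d.+1}) : (h f <= d)%N by rewrite -ltnS.
pose J2 (h : {ffun 'I_n -> 'I_d.+1}) := [set l : 'I_d | (l < h f)%N].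
have cJ2 h : #|J2 h| = h f.
  exact: card_ltn_ord.
have [z zP] : exists z : 'I_d -> 'cV[F]_d, {in A, forall h,
    \dim (W h + \sum_(l in J2 h) <[linfun (mulmx B) (z l)]>) =
    (\dim (W h) + #|J2 h|)%N}.
  (* For one h, column l of Z selects the packet of the l-th helper in J h. The default of [nth] is
     not reached, as l < h f = #|J h|. *)
  apply: (@common_choice F 'cV[F]_M 'cV[F]_d 'I_d _
    (fun=> linfun (mulmx B)) A W J2
    (fun h l => \col_(u < d) (u == nth l (enum (J h)) l :> nat)%:R)) => // h hA.
  have [cJ _] := JP h hA.
  apply: (dimv_add_lines_eq (X :=
    (W h + \sum_(j in J h) <[linfun (mulmx (Q (x j))) (b j)]>)%VS)); last first.
    by rewrite bP // cJ cJ2.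
  apply: addvS => //; apply/subv_sumP=> j jJ; rewrite -memvE.
  have lt_h : (index j (enum (J h)) < h f)%N by rewrite -cJ cardE index_mem mem_enum.
  pose l := Ordinal (leq_trans lt_h (hd h)).
  have lJ2 : l \in J2 h by rewrite inE.
  apply: (subvP (sumv_sup l lJ2 (subvv _))).
  by rewrite !lfunE /= nth_index ?mem_enum // mul_col_delta colB memv_line.
exists ([ffun j => b j], \matrix_(u, l) z l u 0); apply/forall_inP=> h hA.
set Q' := repair _ _ _.
have Q'f : Q' f = B *m (\matrix_(u, l) z l u 0).
  rewrite /Q' /repair eqxx /repaired /=; congr (_ *m _).
  by apply/matrixP=> u j; rewrite !mxE ffunE.
have -> : prefix_span Q' (fun i => h i) =
    (W h + \sum_(l in J2 h) <[linfun (mulmx B) (z l)]>)%VS.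
  rewrite /prefix_span (bigD1 f) //= addvC; congr (_ + _)%VS.
    apply: eq_bigr => i /negPf nif; apply: eq_bigr => l _.
    by rewrite /Q' /repair nif.
  rewrite (eq_bigl (fun l => l \in J2 h)) => [|l]; last by rewrite inE.
  apply: eq_bigr => l _; rewrite Q'f lfunE /= colE -mulmxA -colE.
  by congr (<[_ *m _]>)%VS; apply/colP=> u; rewrite !mxE.
rewrite zP // dimW // cJ2 (bigD1 f) //= {1}/h0 eqxx add0n [X in _ == X](bigD1 f) //=.
rewrite addnC; apply/eqP; congr addn.
by apply: eq_bigr => i /negPf nif; rewrite /h0 nif.
Qed.

(** An independent h of sum M supported on s makes the prefixes span the whole space. A row vector
    killing all matrices of s kills this span, so it is 0. *)
Lemma good_code_rank (F : fieldType) (n M d k : nat) (Q : code F n M d)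
    (s : k.-tuple 'I_n) :
  large_cuts n d M -> (M <= cut d [set i in s])%N -> good_code Q ->
  \rank (\mxrow_(j < k) Q (tnth s j)) = M.
Proof.
move=> satM /(independent_base satM)[h [hP hK sum_h]] Qgood.
have dim_h := good_codeP Qgood hP.
have full : prefix_span Q h = fullv.
  by apply/eqP; rewrite eqEdim subvf dim_h sum_h dimv_full_col leqnn.
set A := \mxrow_j _.
suff : kermx A = 0 by move/eqP; rewrite kermx_eq0 => /eqP.
apply/row_matrixP=> i; rewrite row0; set u := row i _.
have uA : u *m A = 0 by rewrite -row_mul mulmx_ker row0.
have uQ j : j \in s -> u *m Q j = 0.
  move=> /tnthP[l ->]; have := congr1 (fun B => submxrow B l) uA.
  by rewrite /A mul_mxrow mxrowK submxrow0.
have u0 w : u *m w = 0 :> 'M_1.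
  have : w \in prefix_span Q h by rewrite full memvf.
  case/memv_sumP=> v vP ->; rewrite mulmx_sumr big1 // => j _.
  have /memv_sumP[v' v'P ->] := vP j isT.
  rewrite mulmx_sumr big1 // => l lh; have /vlineP[a ->] := v'P l lh.
  rewrite -scalemxAr colE mulmxA uQ ?mul0mx ?scaler0 //.
  by apply: contraTT lh => js; rewrite hK ?inE.
apply/rowP=> j; have := congr1 (fun X : 'M_1 => X 0 0) (u0 (delta_mx j 0)).
by rewrite -colE !mxE.
Qed.

(** * The strategy and its runs *)

Definition replay (F : fieldType) (n M d : nat) (Q : code F n M d)
    (hist : history F n d) : code F n M d :=
  foldl (fun Q p => repair Q p.1 p.2) Q hist.

(** A strategy sees the history but not the code, which is therefore recomputed. The zero default is
    not reached from a good code on a valid event. *)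
Definition good_strategy (F : finFieldType) (n M d : nat) (Q0 : code F n M d) :
    strategy F n d :=
  fun hist e => choice_of (odflt ([ffun=> 0], 0)
    [pick c : finite_choice F d | good_code (repair (replay Q0 hist) e (choice_of c))]).

Lemma good_code_run (F : finFieldType) (n M d : nat) (Q0 : code F n M d)
    (hist : history F n d) (evs : seq (event n d)) :
  large_cuts n d M -> (#|independent_vectors n d M| < #|F|)%N ->
  good_code (replay Q0 hist) -> all (@valid_event n d) evs ->
  good_code (run (good_strategy Q0) hist (replay Q0 hist) evs).
Proof.
move=> satM lt_F; elim: evs hist => [|e evs IH] hist //= Qgood /andP[e_ok evs_ok].
set c := good_strategy Q0 hist e.
have -> : repair (replay Q0 hist) e c = replay Q0 (rcons hist (e, c)).
  by rewrite /replay foldl_rcons.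
apply: IH => //; rewrite /replay foldl_rcons /= -/(replay Q0 hist) /c /good_strategy.
case: pickP => [c' //|no].
by have [c'] := good_code_repair satM lt_F Qgood e_ok; rewrite no.
Qed.

Theorem mainTheorem1 (n k d r M : nat) (F : finFieldType)
  (d_ge1 : (1 <= d)%N) (k_ge1 : (1 <= k)%N) (k_le_n : (k <= n)%N)
  (ndr : (n - d - r = 2)%N) (n_even : (n %% 2 = 0)%N)
  (M_def : M%:Z = file_size n k d) (M_gt0 : (0 < M)%N)
  (F_large : (n * d * M * #|Hset n d M| < #|F|)%N) :
  exists (Q0 : code F n M d) (sigma : strategy F n d),
    forall evs : seq (event n d), all (@valid_event n d) evs ->
    forall s : k.-tuple 'I_n, uniq s ->
      \rank (\mxrow_(j < k) run sigma [::] Q0 evs (tnth s j)) = M.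
Proof.
have satM : large_cuts n d M.
  by move=> S dS; apply: (file_size_le_cut k_le_n n_even M_def); rewrite dS orbT.
have lt_F : (#|independent_vectors n d M| < #|F|)%N.
  (* Since n, d and M are positive, the field size exceeds the cardinality of H itself. *)
  apply: leq_ltn_trans F_large.
  apply: leq_trans (subset_leq_card (independent_vectors_sub satM)) _.
  by rewrite leq_pmull // !muln_gt0 M_gt0 d_ge1 (leq_trans k_ge1 k_le_n).
have [Q0 Q0good] := good_code_init lt_F.
exists Q0, (good_strategy Q0) => evs evs_ok s s_uniq.
apply: good_code_rank => //; last exact: (good_code_run (hist := [::])).
apply: (file_size_le_cut k_le_n n_even M_def).
by rewrite cardsE (card_uniqP s_uniq) size_tuple leqnn.
Qed.
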